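(* Let $R$ be a commutative artin ring and $(\mathcal{C},\mathbb{E},\mathfrak{s})$ an $R$-linear Ext-finite extriangulated category which is weakly idempotent complete, has a right ARS duality $(\tau,\eta)$, and has enough projectives $\mathcal{Q}$ and enough injectives $\mathcal{J}$, both functorially finite in $\mathcal{C}$. Let $(\tau,\phi):(\underline{\mathcal{C}},\underline{\mathbb{E}^{\mathcal{Q}}},\underline{\mathfrak{s}|_{\mathbb{E}^{\mathcal{Q}}}})\to(\overline{\mathcal{C}},\overline{\mathbb{E}_{\mathcal{J}}},\overline{\mathfrak{s}|_{\mathbb{E}_{\mathcal{J}}}})$ be the exact functor with $\phi$ constructed from $(\tau,\eta)$ as recalled in the context. Suppose $\delta\in\underline{\mathbb{E}^{\mathcal{Q}}}(C,A)$ is an almost split extension in $(\underline{\mathcal{C}},\underline{\mathbb{E}^{\mathcal{Q}}},\underline{\mathfrak{s}|_{\mathbb{E}^{\mathcal{Q}}}})$. Then $\phi_{C,A}(\delta)\in\overline{\mathbb{E}_{\mathcal{J}}}(\tau C,\tau A)$ is an almost split extension in $(\overline{\mathcal{C}},\overline{\mathbb{E}_{\mathcal{J}}},\overline{\mathfrak{s}|_{\mathbb{E}_{\mathcal{J}}}})$. Thus, if $A\xrightarrow{\underline{x}}B\xrightarrow{\underline{y}}C\overset{\delta}{\dashrightarrow}$ is an almost split $\underline{\mathfrak{s}|_{\mathbb{E}^{\mathcal{Q}}}}$-triangle, then $\tau A\xrightarrow{\tau(\underline{x})}\tau B\xrightarrow{\tau(\underline{y})}\tau C\overset{\phi_{C,A}(\delta)}{\dashrightarrow}$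 is an almost split $\overline{\mathfrak{s}|_{\mathbb{E}_{\mathcal{J}}}}$-triangle.
   Context: $J$ is the minimal injective cogenerator of the category $\mathrm{mod}R$ of finitely generated $R$-modules and $\mathbb{D}=\mathrm{Hom}_R(-,J)$. Extriangulated categories (Nakaoka–Palu). An $R$-linear extriangulated category is a triplet $(\mathcal{C},\mathbb{E},\mathfrak{s})$ where $\mathcal{C}$ is an $R$-linear additive category, (ET1) $\mathbb{E}:\mathcal{C}^{\rm op}\times\mathcal{C}\to\mathrm{Mod}R$ is an $R$-bilinear functor, (ET2) $\mathfrak{s}$ is an additive realization of $\mathbb{E}$, and (ET3), (ET4) and their duals hold. For $\delta\in\mathbb{E}(C,A)$, $c:C'\to C$, $a:A\to A'$ write $c^*\delta=\mathbb{E}(c,A)(\delta)$, $a_*\delta=\mathbb{E}(C,a)(\delta)$. A morphism $\delta\to\delta'$ from $\delta\in\mathbb{E}(C,A)$ to $\delta'\in\mathbb{E}(C',A')$ is a pair $(a:A\to A',c:C\to C')$ with $a_*\delta=c^*\delta'$. An additive realization assigns to each $\delta\in\mathbb{E}(C,A)$ an equivalence class $\mathfrak{s}(\delta)=[A\to B\to C]$ (sequences equivalent if there is an isomorphism of middle terms compatible with $\mathrm{id}_A,\mathrm{id}_C$) such that each morphism $(a,c):\delta\to\delta'$ extends to a commutative diagram between realizing sequences, $\mathfrak{s}(0)=[A\to A\oplus C\to C]$, and $\mathfrak{s}(\delta\oplus\delta')=\mathfrak{s}(\delta)\oplus\mathfrak{s}(\delta')$. (ET3): if $\mathfrak{s}(\delta)=[A\xrightarrow{x}B\xrightarrow{y}C]$,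 $\mathfrak{s}(\delta')=[A'\xrightarrow{x'}B'\xrightarrow{y'}C']$ and $bx=x'a$, there is $c$ with $cy=y'b$ and $(a,c):\delta\to\delta'$ a morphism. (ET4): if $\delta\in\mathbb{E}(D,A)$, $\delta'\in\mathbb{E}(F,B)$ are realized by $A\xrightarrow{f}B\xrightarrow{f'}D$, $B\xrightarrow{g}C\xrightarrow{g'}F$, there are $E$, $d:D\to E$, $e:E\to F$, $h'\colon C\to E$ and $\delta''\in\mathbb{E}(E,A)$ realized by $A\xrightarrow{h=gf}C\xrightarrow{h'}E$ with $h'g=df'$, $eh'=g'$, such that $D\xrightarrow{d}E\xrightarrow{e}F$ realizes $f'_*\delta'$, $d^*\delta''=\delta$, $f_*\delta''=e^*\delta'$. If $\mathfrak{s}(\delta)=[A\xrightarrow{a}B\xrightarrow{b}C]$, then $A\xrightarrow{a}B\xrightarrow{b}C\overset{\delta}{\dashrightarrow}$ is an $\mathfrak{s}$-triangle. Almost split: in an extriangulated category $(\mathcal{C},\mathbb{E},\mathfrak{s})$, a non-split (i.e. nonzero) extension $\delta\in\mathbb{E}(C,A)$ is almost split if (AS1) $a_*\delta=0$ for every non-section $a:A\to A'$ and (AS2) $c^*\delta=0$ for every non-retraction $c:C'\to C$. An $\mathfrak{s}$-triangle $A\to B\to C\overset{\delta}{\dashrightarrow}$ is almost split if $\delta$ is. Ext-finite: every $\mathbb{E}(C,A)$ is a finitely generated $R$-module. Weakly idempotent complete: every retraction in $\mathcal{C}$ has a kernel. $P$ is projective if $\mathbb{E}(P,-)=0$; $\mathcal{C}$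 has enough projectives if every $C$ admits an $\mathfrak{s}$-triangle $A\to P\to C\dashrightarrow$ with $P$ projective; injectives dually. ''Enough projectives $\mathcal{Q}$ / injectives $\mathcal{J}$'' means that $\mathcal{Q}$, $\mathcal{J}$ are the full subcategories of all projective, resp. injective, objects. ARS duality. $\mathcal{P}_{\mathbb{E}}$ (resp. $\mathcal{I}_{\mathbb{E}}$) is the ideal of morphisms $f$ with $\mathbb{E}(f,-)=0$ (resp. $\mathbb{E}(-,f)=0$); $\underline{\mathcal{C}}=\mathcal{C}/\mathcal{P}_{\mathbb{E}}$, $\overline{\mathcal{C}}=\mathcal{C}/\mathcal{I}_{\mathbb{E}}$; $\mathbb{E}$ induces $\underline{\mathcal{C}}^{\rm op}\times\overline{\mathcal{C}}\to\mathrm{Mod}R$. A right Auslander–Reiten–Serre (ARS) duality is a pair $(\tau,\eta)$ of an $R$-linear functor $\tau:\underline{\mathcal{C}}\to\overline{\mathcal{C}}$ and a binatural isomorphism of $R$-modules $\eta_{A,B}:\underline{\mathcal{C}}(A,B)\simeq\mathbb{D}\mathbb{E}(B,\tau A)$. Put $\eta_A:=\eta_{A,A}(\underline{\mathrm{id}_A}):\mathbb{E}(A,\tau A)\to J$. With enough projectives and injectives, $\mathcal{P}_{\mathbb{E}}=[\mathcal{Q}]$, $\mathcal{I}_{\mathbb{E}}=[\mathcal{J}]$, where $[\mathcal{X}]$ is the ideal of morphisms factoring through $\mathcal{X}$. Relative structures. For a full subcategory $\mathcal{D}\subseteq\mathcal{C}$: $\mathbb{E}_{\mathcal{D}}(C,A)=\{\delta\in\mathbb{E}(C,A)\mid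 d^*\delta=0\ \forall d:D\to C,\ D\in\mathcal{D}\}$ and $\mathbb{E}^{\mathcal{D}}(C,A)=\{\delta\in\mathbb{E}(C,A)\mid d_*\delta=0\ \forall d:A\to D,\ D\in\mathcal{D}\}$; with the restrictions of $\mathfrak{s}$ these are extriangulated structures on $\mathcal{C}$. $(\underline{\mathcal{C}},\underline{\mathbb{E}^{\mathcal{Q}}},\underline{\mathfrak{s}|_{\mathbb{E}^{\mathcal{Q}}}})$ (resp. $(\overline{\mathcal{C}},\overline{\mathbb{E}_{\mathcal{J}}},\overline{\mathfrak{s}|_{\mathbb{E}_{\mathcal{J}}}})$) is the ideal quotient of $(\mathcal{C},\mathbb{E}^{\mathcal{Q}},\mathfrak{s}|_{\mathbb{E}^{\mathcal{Q}}})$ by $\mathcal{Q}$ (resp. of $(\mathcal{C},\mathbb{E}_{\mathcal{J}},\mathfrak{s}|_{\mathbb{E}_{\mathcal{J}}})$ by $\mathcal{J}$): the same extension groups, realized by the classes of the realizing sequences in the quotient category. Exact functor $(F,\phi):(\mathcal{C},\mathbb{E},\mathfrak{s})\to(\mathcal{C}',\mathbb{E}',\mathfrak{s}')$: an $R$-linear functor $F$ and a natural transformation $\phi:\mathbb{E}\Rightarrow\mathbb{E}'\circ(F^{\rm op}\times F)$ with $\mathfrak{s}'(\phi_{C,A}(\delta))=[FA\xrightarrow{Fx}FB\xrightarrow{Fy}FC]$ for every $\mathfrak{s}$-triangle $A\xrightarrow{x}B\xrightarrow{y}C\overset{\delta}{\dashrightarrow}$. Definition of $\phi$. Put $\mathcal{W}=\mathrm{add}(\mathcal{Q}\cup\mathcal{J})$;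 for the relative structures $\mathcal{I}_{\mathbb{E}^{\mathcal{Q}}}=\mathcal{P}_{\mathbb{E}_{\mathcal{J}}}=[\mathcal{W}]$. $\phi_{C,A}:\mathbb{E}^{\mathcal{Q}}(C,A)\to\mathbb{E}_{\mathcal{J}}(\tau C,\tau A)$ is the composite of the natural isomorphisms $\mathbb{E}^{\mathcal{Q}}(C,A)\simeq\mathbb{D}\big((\mathcal{C}/[\mathcal{W}])(A,\tau C)\big)$, $\delta\mapsto([f]\mapsto\eta_C(f_*\delta))$, and the inverse of $\mathbb{E}_{\mathcal{J}}(\tau C,\tau A)\simeq\mathbb{D}\big((\mathcal{C}/[\mathcal{W}])(A,\tau C)\big)$, $\varepsilon\mapsto([f]\mapsto\eta_A(f^*\varepsilon))$. So $\phi_{C,A}(\delta)$ is the unique element with $\eta_A(f^*\phi_{C,A}(\delta))=\eta_C(f_*\delta)$ for all $f\in\mathcal{C}(A,\tau C)$. With this $\phi$, $(\tau,\phi)$ is an exact functor. *)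

(* Defs.v *)
From HB Require Import structures.
From mathcomp Require Import all_boot all_algebra ring_quotient.
From mathcomp Require Import boolp.

Set Implicit Arguments.
Unset Strict Implicit.
Unset Printing Implicit Defensive.

Import GRing.Theory.
Local Open Scope ring_scope.
Local Open Scope quotient_scope.

(** * Modules *)

Section Submodules.
Variables (R : pzRingType) (V : lmodType R).

Definition submod_axiom (P : V -> Prop) : Prop :=
  P 0 /\ forall (a : R) (u v : V), P u -> P v -> P (a *: u + v).

Record submod := Submod { smem :> V -> Prop; smemP : submod_axiom smem }.

Definition smemb (S : submod) : V -> bool := fun v => `[< S v >].

Lemma smembP (S : submod) v : reflect (S v) (v \in smemb S).
Proof. exact: asboolP. Qed.

Lemma smemb_closed (S : submod) : subsemimod_closed (smemb S).
Proof.
have [S0 SL] := smemP S; split; first split.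
- exact/smembP.
- move=> u v /smembP Su /smembP Sv; apply/smembP.
  by rewrite -[u]scale1r; apply: SL.
- move=> a v /smembP Sv; apply/smembP.
  by rewrite -[_ *: _]addr0; apply: SL.
Qed.

HB.instance Definition _ (S : submod) :=
  GRing.isSubmodClosed.Build R V (smemb S) (smemb_closed S).

Record subm (S : submod) := Subm { subm_val : V; subm_valb : subm_val \in smemb S }.

HB.instance Definition _ (S : submod) := [isSub for @subm_val S].
HB.instance Definition _ (S : submod) := [Choice of subm S by <:].
HB.instance Definition _ (S : submod) :=
  [SubChoice_isSubLmodule of subm S by <:].

Lemma subm_valP (S : submod) (u : subm S) : S (subm_val u).
Proof. exact/smembP/subm_valb. Qed.

Definition mk_subm (S : submod) (v : V) (Sv : S v) : subm S :=
  Subm (introT (smembP S v) Sv).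

Definition smemz (S : submod) : zmodClosed V :=
  GRing.ZmodClosed.clone V (smemb S) _.

Definition quotm (S : submod) : Type := Quotient.quot (smemz S).

HB.instance Definition _ (S : submod) := GRing.Zmodule.on (quotm S).

Definition cls (S : submod) (v : V) : quotm S := \pi_(Quotient.quot (smemz S)) v.
Definition rep (S : submod) (q : quotm S) : V := repr (q : Quotient.quot (smemz S)).

Lemma repK (S : submod) : cancel (@rep S) (@cls S).
Proof. exact: reprK. Qed.

Lemma clsP (S : submod) (u v : V) : cls S u = cls S v <-> S (u - v).
Proof.
split=> [/eqP|] h; first by apply/smembP; rewrite (Quotient.idealrBE (smemz S)).
by apply/eqP; rewrite -(Quotient.idealrBE (smemz S)); apply/smembP.
Qed.

Lemma clsD (S : submod) : {morph cls S : u v / u + v}.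
Proof. by move=> u v; exact: Quotient.pi_add. Qed.

Definition qscale (S : submod) (a : R) (q : quotm S) : quotm S :=
  cls S (a *: rep q).

Lemma qscale_cls (S : submod) a v : qscale a (cls S v) = cls S (a *: v).
Proof.
apply/clsP; rewrite -scalerBr -[_ *: _]addr0.
have [S0 SL] := smemP S; apply: SL => //; exact/clsP/repK.
Qed.

Fact qscaleA S a b (q : quotm S) : qscale a (qscale b q) = qscale (a * b) q.
Proof. by rewrite -[q]repK !qscale_cls scalerA. Qed.
Fact qscale1 S : left_id 1 (@qscale S).
Proof. by move=> q; rewrite -[q]repK qscale_cls scale1r. Qed.
Fact qscaleDr S : right_distributive (@qscale S) +%R.
Proof.
move=> a p q; rewrite -[p]repK -[q]repK.
by rewrite -clsD !qscale_cls scalerDr clsD.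
Qed.
Fact qscaleDl S (q : quotm S) : {morph (@qscale S)^~ q : a b / a + b}.
Proof.
by move=> a b /=; rewrite -[q]repK !qscale_cls scalerDl clsD.
Qed.

HB.instance Definition _ (S : submod) :=
  GRing.Zmodule_isLmodule.Build R (quotm S)
    (@qscaleA S) (@qscale1 S) (@qscaleDr S) (@qscaleDl S).

Fact cls_is_linear (S : submod) : linear (cls S).
Proof. by move=> a u v; rewrite clsD -qscale_cls. Qed.

HB.instance Definition _ (S : submod) :=
  GRing.isLinear.Build R V (quotm S) _ (cls S) (cls_is_linear S).

End Submodules.

Section Dual.
Variables (R : comPzRingType) (J : lmodType R) (M : lmodType R).

Definition dual : Type := {linear M -> J}.

HB.instance Definition _ := gen_eqMixin dual.
HB.instance Definition _ := gen_choiceMixin dual.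

Lemma dual_ext (f g : dual) : f =1 g -> f = g.
Proof.
case: f g => [f [[fA] [fS]]] [g [[gA] [gS]]] /= /funext fg.
case: g / fg gA gS => gA gS.
by rewrite (Prop_irrelevance fA gA) (Prop_irrelevance fS gS).
Qed.

Definition dual0 : dual := \0%R : {linear M -> J}.
Definition dual_add (f g : dual) : dual :=
  (f : {linear M -> J}) \+ (g : {linear M -> J}).
Definition dual_scale (a : R) (f : dual) : dual := a \*: (f : {linear M -> J}).
Definition dual_opp (f : dual) : dual := dual_scale (-1) f.

Fact dual_addA : associative dual_add.
Proof. by move=> f g h; apply: dual_ext => x /=; rewrite addrA. Qed.
Fact dual_addC : commutative dual_add.
Proof. by move=> f g; apply: dual_ext => x /=; rewrite addrC. Qed.
Fact dual_add0 : left_id dual0 dual_add.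
Proof. by move=> f; apply: dual_ext => x /=; rewrite add0r. Qed.
Fact dual_addN : left_inverse dual0 dual_opp dual_add.
Proof. by move=> f; apply: dual_ext => x /=; rewrite scaleN1r addNr. Qed.

HB.instance Definition _ :=
  GRing.isZmodule.Build dual dual_addA dual_addC dual_add0 dual_addN.

Fact dual_scaleA a b f : dual_scale a (dual_scale b f) = dual_scale (a * b) f.
Proof. by apply: dual_ext => x /=; rewrite scalerA. Qed.
Fact dual_scale1 : left_id 1 dual_scale.
Proof. by move=> f; apply: dual_ext => x /=; rewrite scale1r. Qed.
Fact dual_scaleDr : right_distributive dual_scale +%R.
Proof. by move=> a f g; apply: dual_ext => x /=; rewrite scalerDr. Qed.
Fact dual_scaleDl f : {morph dual_scale^~ f : a b / a + b}.
Proof. by move=> a b; apply: dual_ext => x /=; rewrite scalerDl. Qed.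

HB.instance Definition _ := GRing.Zmodule_isLmodule.Build R dual
  dual_scaleA dual_scale1 dual_scaleDr dual_scaleDl.

End Dual.

(** * Finiteness conditions on rings and modules *)

Definition artinian (R : comPzRingType) : Prop :=
  forall I : nat -> submod R^o,
    (forall n x, I n.+1 x -> I n x) ->
    exists N, forall n, (N <= n)%N -> forall x, I n x <-> I N x.

Definition fin_gen (R : pzRingType) (M : lmodType R) : Prop :=
  exists (n : nat) (v : 'I_n -> M),
    forall m : M, exists a : 'I_n -> R, m = \sum_(i < n) a i *: v i.

Section Cogenerators.
Variable R : pzRingType.

Definition injective_mod (J : lmodType R) : Prop :=
  forall (M N : lmodType R) (i : {linear M -> N}) (f : {linear M -> J}),
    fin_gen M -> fin_gen N -> injective i ->
    exists g : {linear N -> J}, forall m, g (i m) = f m.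

Definition cogenerator_mod (J : lmodType R) : Prop :=
  forall (M N : lmodType R) (f : {linear M -> N}),
    fin_gen M -> fin_gen N -> (exists m, f m != 0) ->
    exists (g : {linear N -> J}) (m : M), g (f m) != 0.

Definition injective_cogenerator (J : lmodType R) : Prop :=
  [/\ fin_gen J, injective_mod J & cogenerator_mod J].

(* [mod R] has Krull-Schmidt and an embedding of an injective object splits, so
   the injective cogenerator that embeds in all the others is the direct sum of
   the injective envelopes of the simple modules, one for each isoclass. *)
Definition minimal_injective_cogenerator (J : lmodType R) : Prop :=
  injective_cogenerator J /\
  forall J' : lmodType R, injective_cogenerator J' ->
    exists i : {linear J -> J'}, injective i.

End Cogenerators.

(** * R-linear categories *)

Record lincat (R : pzRingType) := LinCat {
  obj :> Type;
  mor : obj -> obj -> lmodType R;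
  idm : forall A, mor A A;
  mcomp : forall A B C, mor B C -> mor A B -> mor A C;
  comp_assoc : forall A B C D (h : mor C D) (g : mor B C) (f : mor A B),
    mcomp h (mcomp g f) = mcomp (mcomp h g) f;
  comp_idl : forall A B (f : mor A B), mcomp (idm B) f = f;
  comp_idr : forall A B (f : mor A B), mcomp f (idm A) = f;
  comp_linl : forall A B C (f : mor A B) (a : R) (g g' : mor B C),
    mcomp (a *: g + g') f = a *: mcomp g f + mcomp g' f;
  comp_linr : forall A B C (g : mor B C) (a : R) (f f' : mor A B),
    mcomp g (a *: f + f') = a *: mcomp g f + mcomp g f'
}.

Arguments mor {R} l A B.
Arguments idm {R l} A.
Arguments mcomp {R l A B C} g f.
Notation "g \c f" := (mcomp g f) (at level 40, left associativity) : ring_scope.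

Section LinCat.
Variables (R : pzRingType) (C : lincat R).

Definition is_zero_obj (Z : C) : Prop := idm Z = 0.

Definition is_biproduct (A B S : C) (iA : mor C A S) (iB : mor C B S)
    (pA : mor C S A) (pB : mor C S B) : Prop :=
  [/\ pA \c iA = idm A, pB \c iB = idm B, pA \c iB = 0, pB \c iA = 0
    & iA \c pA + iB \c pB = idm S].

Definition additive_cat : Prop :=
  (exists Z : C, is_zero_obj Z) /\
  forall A B : C, exists (S : C) (iA : mor C A S) (iB : mor C B S)
    (pA : mor C S A) (pB : mor C S B), is_biproduct iA iB pA pB.

Definition is_iso (A B : C) (f : mor C A B) : Prop :=
  exists g : mor C B A, g \c f = idm A /\ f \c g = idm B.

Definition is_section (A B : C) (f : mor C A B) : Prop :=
  exists r : mor C B A, r \c f = idm A.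

Definition is_retraction (A B : C) (f : mor C A B) : Prop :=
  exists s : mor C B A, f \c s = idm B.

Definition is_kernel (K A B : C) (k : mor C K A) (f : mor C A B) : Prop :=
  f \c k = 0 /\
  forall (X : C) (g : mor C X A), f \c g = 0 ->
    exists! h : mor C X K, k \c h = g.

Definition weakly_idempotent_complete : Prop :=
  forall (A B : C) (f : mor C A B), is_retraction f ->
    exists (K : C) (k : mor C K A), is_kernel k f.

Definition seq_equiv (A D B B' : C) (x : mor C A B) (y : mor C B D)
    (x' : mor C A B') (y' : mor C B' D) : Prop :=
  exists b : mor C B B', [/\ is_iso b, b \c x = x' & y' \c b = y].

(* Full subcategories are given by predicates on objects. *)
Definition factors_through (P : C -> Prop) (A B : C) (f : mor C A B) : Prop :=
  exists (X : C) (g : mor C X B) (h : mor C A X), P X /\ f = g \c h.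

Definition contravariantly_finite (P : C -> Prop) : Prop :=
  forall B : C, exists (X : C) (g : mor C X B), P X /\
    forall (Y : C) (h : mor C Y B), P Y -> exists k : mor C Y X, h = g \c k.

Definition covariantly_finite (P : C -> Prop) : Prop :=
  forall A : C, exists (X : C) (g : mor C A X), P X /\
    forall (Y : C) (h : mor C A Y), P Y -> exists k : mor C X Y, h = k \c g.

Definition functorially_finite (P : C -> Prop) : Prop :=
  contravariantly_finite P /\ covariantly_finite P.

End LinCat.

Record functor (R : pzRingType) (C D : lincat R) := Functor {
  fobj :> C -> D;
  fmap : forall A B : C, {linear mor C A B -> mor D (fobj A) (fobj B)};
  fmap_id : forall A : C, fmap A A (idm A) = idm (fobj A);
  fmap_comp : forall (A B E : C) (g : mor C B E) (f : mor C A B),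
    fmap A E (g \c f) = fmap B E g \c fmap A B f
}.

Arguments fmap {R C D} _ {A B}.

(** * Ideal quotients *)

Record ideal (R : pzRingType) (C : lincat R) := Ideal {
  imem :> forall A B : C, submod (mor C A B);
  imem_l : forall (A B D : C) (g : mor C B D) (f : mor C A B),
    imem A B f -> imem A D (g \c f);
  imem_r : forall (A B D : C) (g : mor C B D) (f : mor C A B),
    imem B D g -> imem A D (g \c f)
}.

Section QuotCat.
Variables (R : pzRingType) (C : lincat R) (I : ideal C).

Definition qhom (A B : C) : lmodType R := quotm (I A B).

Definition qid (A : C) : qhom A A := cls (I A A) (idm A).

Definition qcomp (A B D : C) (g : qhom B D) (f : qhom A B) : qhom A D :=
  cls (I A D) (rep g \c rep f).

Lemma comp_subl (A B D : C) (g g' : mor C B D) (f : mor C A B) :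
  (g - g') \c f = g \c f - g' \c f.
Proof.
by rewrite addrC -scaleN1r comp_linl scaleN1r addrC.
Qed.

Lemma comp_subr (A B D : C) (g : mor C B D) (f f' : mor C A B) :
  g \c (f - f') = g \c f - g \c f'.
Proof.
by rewrite addrC -scaleN1r comp_linr scaleN1r addrC.
Qed.

Lemma rep_cls (A B : C) (f : mor C A B) : I A B (rep (cls (I A B) f) - f).
Proof. exact/clsP/repK. Qed.

Lemma qcomp_cls (A B D : C) (g : mor C B D) (f : mor C A B) :
  qcomp (cls (I B D) g) (cls (I A B) f) = cls (I A D) (g \c f).
Proof.
apply/clsP; set g' := rep _; set f' := rep _.
have -> : g' \c f' - g \c f = 1 *: (g' \c (f' - f)) + (g' - g) \c f.
  by rewrite comp_subl comp_subr scale1r addrA subrK.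
apply: (smemP (I A D)).2; first exact/imem_l/rep_cls.
exact/imem_r/rep_cls.
Qed.

Fact qcompA (A B D E : C) (h : qhom D E) (g : qhom B D) (f : qhom A B) :
  qcomp h (qcomp g f) = qcomp (qcomp h g) f.
Proof.
by rewrite -[h]repK -[g]repK -[f]repK !qcomp_cls comp_assoc.
Qed.
Fact qcomp1m (A B : C) (f : qhom A B) : qcomp (qid B) f = f.
Proof. by rewrite -[f]repK qcomp_cls comp_idl. Qed.
Fact qcompm1 (A B : C) (f : qhom A B) : qcomp f (qid A) = f.
Proof. by rewrite -[f]repK qcomp_cls comp_idr. Qed.
Fact qcomp_linl (A B D : C) (f : qhom A B) (a : R) (g g' : qhom B D) :
  qcomp (a *: g + g') f = a *: qcomp g f + qcomp g' f.
Proof.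
rewrite -[f]repK -[g]repK -[g']repK -linearP !qcomp_cls comp_linl.
by rewrite linearP.
Qed.
Fact qcomp_linr (A B D : C) (g : qhom B D) (a : R) (f f' : qhom A B) :
  qcomp g (a *: f + f') = a *: qcomp g f + qcomp g f'.
Proof.
rewrite -[g]repK -[f]repK -[f']repK -linearP !qcomp_cls comp_linr.
by rewrite linearP.
Qed.

Definition quot_cat : lincat R := {|
  obj := obj C; mor := qhom; idm := qid; mcomp := qcomp;
  comp_assoc := qcompA; comp_idl := qcomp1m; comp_idr := qcompm1;
  comp_linl := qcomp_linl; comp_linr := qcomp_linr |}.

End QuotCat.

(** * Bifunctors C^op x D -> Mod R *)

(* An element of [ext E X A] has its contravariant end [X] first; [pull c d] is
   c^* d and [push a d] is a_* d. *)
Record bifun (R : pzRingType) (C D : lincat R) := Bifun {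
  ext :> C -> D -> lmodType R;
  pull : forall (X X' : C) (A : D), mor C X' X -> ext X A -> ext X' A;
  push : forall (X : C) (A A' : D), mor D A A' -> ext X A -> ext X A';
  pull_id : forall X A (d : ext X A), pull (idm X) d = d;
  pull_comp : forall X X' X'' A (c : mor C X' X) (c' : mor C X'' X')
    (d : ext X A), pull (c \c c') d = pull c' (pull c d);
  push_id : forall X A (d : ext X A), push (idm A) d = d;
  push_comp : forall X A A' A'' (a' : mor D A' A'') (a : mor D A A')
    (d : ext X A), push (a' \c a) d = push a' (push a d);
  pull_push : forall X X' A A' (c : mor C X' X) (a : mor D A A') (d : ext X A),
    pull c (push a d) = push a (pull c d);
  pull_lin : forall X X' A (c : mor C X' X) r (d d' : ext X A),
    pull c (r *: d + d') = r *: pull c d + pull c d';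
  push_lin : forall X A A' (a : mor D A A') r (d d' : ext X A),
    push a (r *: d + d') = r *: push a d + push a d';
  pull_lin_hom : forall X X' A r (c c' : mor C X' X) (d : ext X A),
    pull (r *: c + c') d = r *: pull c d + pull c' d;
  push_lin_hom : forall X A A' r (a a' : mor D A A') (d : ext X A),
    push (r *: a + a') d = r *: push a d + push a' d
}.

Arguments pull {R C D} b {X X' A} c d.
Arguments push {R C D} b {X A A'} a d.

Section Bifun.
Variables (R : pzRingType) (C D : lincat R) (E : bifun C D).

Lemma pull0 X X' A (c : mor C X' X) : pull E c (0 : E X A) = 0.
Proof.
by have := pull_lin c (-1) (0 : E X A) 0; rewrite !scaleN1r oppr0 addr0 addNr.
Qed.
Lemma push0 X A A' (a : mor D A A') : push E a (0 : E X A) = 0.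
Proof.
by have := push_lin a (-1) (0 : E X A) 0; rewrite !scaleN1r oppr0 addr0 addNr.
Qed.
Lemma pull0m X X' A (d : E X A) : pull E (0 : mor C X' X) d = 0.
Proof.
have := pull_lin_hom (-1) (0 : mor C X' X) 0 d.
by rewrite !scaleN1r oppr0 addr0 addNr.
Qed.
Lemma push0m X A A' (d : E X A) : push E (0 : mor D A A') d = 0.
Proof.
have := push_lin_hom (-1) (0 : mor D A A') 0 d.
by rewrite !scaleN1r oppr0 addr0 addNr.
Qed.

Definition killC (X' X : C) (c : mor C X' X) : Prop :=
  forall (A : D) (d : E X A), pull E c d = 0.
Definition killD (A A' : D) (a : mor D A A') : Prop :=
  forall (X : C) (d : E X A), push E a d = 0.

Fact killC_submod X' X : submod_axiom (@killC X' X).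
Proof.
split=> [A d|r c c' kc kc' A d]; first exact: pull0m.
by rewrite pull_lin_hom kc kc' scaler0 addr0.
Qed.
Fact killD_submod A A' : submod_axiom (@killD A A').
Proof.
split=> [X d|r a a' ka ka' X d]; first exact: push0m.
by rewrite push_lin_hom ka ka' scaler0 addr0.
Qed.

Fact killC_l X' X Y (g : mor C X Y) (f : mor C X' X) :
  killC f -> killC (g \c f).
Proof. by move=> kf A d; rewrite pull_comp kf. Qed.
Fact killC_r X' X Y (g : mor C X Y) (f : mor C X' X) :
  killC g -> killC (g \c f).
Proof. by move=> kg A d; rewrite pull_comp kg pull0. Qed.
Fact killD_l A A' B (g : mor D A' B) (f : mor D A A') :
  killD f -> killD (g \c f).
Proof. by move=> kf X d; rewrite push_comp kf push0. Qed.
Fact killD_r A A' B (g : mor D A' B) (f : mor D A A') :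
  killD g -> killD (g \c f).
Proof. by move=> kg X d; rewrite push_comp kg. Qed.

Definition P_ideal : ideal C := {|
  imem := fun X' X => Submod (killC_submod X' X);
  imem_l := killC_l; imem_r := killC_r |}.
Definition I_ideal : ideal D := {|
  imem := fun A A' => Submod (killD_submod A A');
  imem_l := killD_l; imem_r := killD_r |}.

(** ** The induced bifunctor on ideal quotients *)

Section QuotBifun.
Variables (I : ideal C) (K : ideal D).
Hypothesis I_kills : forall X' X (c : mor C X' X), I X' X c -> killC c.
Hypothesis K_kills : forall A A' (a : mor D A A'), K A A' a -> killD a.

Definition qpull (X X' : C) (A : D) (c : mor (quot_cat I) X' X) (d : E X A) :
  E X' A := pull E (rep c) d.
Definition qpush (X : C) (A A' : D) (a : mor (quot_cat K) A A') (d : E X A) :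
  E X A' := push E (rep a) d.

Lemma qpull_cls X X' A (c : mor C X' X) (d : E X A) :
  qpull (cls (I X' X) c) d = pull E c d.
Proof.
have /I_kills/(_ A d) := rep_cls I c.
by rewrite /qpull addrC -scaleN1r pull_lin_hom scaleN1r addrC => /subr0_eq.
Qed.
Lemma qpush_cls X A A' (a : mor D A A') (d : E X A) :
  qpush (cls (K A A') a) d = push E a d.
Proof.
have /K_kills/(_ X d) := rep_cls K a.
by rewrite /qpush addrC -scaleN1r push_lin_hom scaleN1r addrC => /subr0_eq.
Qed.

Program Definition quot_bifun : bifun (quot_cat I) (quot_cat K) := {|
  ext := fun (X : quot_cat I) (A : quot_cat K) => E X A;
  pull := qpull; push := qpush |}.
Next Obligation. by rewrite qpull_cls pull_id. Qed.
Next Obligation. by rewrite qpull_cls pull_comp. Qed.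
Next Obligation. by rewrite qpush_cls push_id. Qed.
Next Obligation. by rewrite qpush_cls push_comp. Qed.
Next Obligation. exact: pull_push. Qed.
Next Obligation. exact: pull_lin. Qed.
Next Obligation. exact: push_lin. Qed.
Next Obligation.
by rewrite -[c]repK -[c']repK -linearP !qpull_cls pull_lin_hom.
Qed.
Next Obligation.
by rewrite -[a]repK -[a']repK -linearP !qpush_cls push_lin_hom.
Qed.

End QuotBifun.

(** ** Sub-bifunctors *)

Section SubBifun.
Variable S : forall X A, submod (E X A).
Hypothesis S_pull : forall X X' A (c : mor C X' X) (d : E X A),
  S X A d -> S X' A (pull E c d).
Hypothesis S_push : forall X A A' (a : mor D A A') (d : E X A),
  S X A d -> S X A' (push E a d).

Definition spull X X' A (c : mor C X' X) (d : subm (S X A)) : subm (S X' A) :=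
  mk_subm (S_pull c (subm_valP d)).
Definition spush X A A' (a : mor D A A') (d : subm (S X A)) : subm (S X A') :=
  mk_subm (S_push a (subm_valP d)).

Program Definition sub_bifun : bifun C D := {|
  ext := fun X A => subm (S X A);
  pull := spull; push := spush |}.
Next Obligation. exact/val_inj/pull_id. Qed.
Next Obligation. exact/val_inj/pull_comp. Qed.
Next Obligation. exact/val_inj/push_id. Qed.
Next Obligation. exact/val_inj/push_comp. Qed.
Next Obligation. exact/val_inj/pull_push. Qed.
Next Obligation. exact/val_inj/pull_lin. Qed.
Next Obligation. exact/val_inj/push_lin. Qed.
Next Obligation. exact/val_inj/pull_lin_hom. Qed.
Next Obligation. exact/val_inj/push_lin_hom. Qed.

End SubBifun.

End Bifun.

(** * Extriangulated categories *)

(* [realizes d x y] means that the sequence x, y lies in the class s(d). *)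
Record extridata (R : pzRingType) := ExtriData {
  xcat :> lincat R;
  xext : bifun xcat xcat;
  realizes : forall A B C : xcat,
    xext C A -> mor xcat A B -> mor xcat B C -> Prop
}.

Arguments realizes {R} e {A B C} d x y.

Section Extriangulated.
Variables (R : pzRingType) (X : extridata R).
Local Notation E := (xext X).
Local Notation mor := (mor X).

Definition realizes_class : Prop := forall (A C : X) (d : E C A),
  (exists (B : X) (x : mor A B) (y : mor B C), realizes X d x y) /\
  forall (B B' : X) (x : mor A B) (y : mor B C) (x' : mor A B') (y' : mor B' C),
    realizes X d x y -> (realizes X d x' y' <-> seq_equiv x y x' y').

Definition realizes_morphisms : Prop :=
  forall (A B C A' B' C' : X) (d : E C A) (d' : E C' A')
    (x : mor A B) (y : mor B C) (x' : mor A' B') (y' : mor B' C')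
    (a : mor A A') (c : mor C C'),
  realizes X d x y -> realizes X d' x' y' -> push E a d = pull E c d' ->
  exists b : mor B B', b \c x = x' \c a /\ y' \c b = c \c y.

Definition realizes_zero : Prop :=
  forall (A C S : X) (iA : mor A S) (iC : mor C S) (pA : mor S A) (pC : mor S C),
  is_biproduct iA iC pA pC -> realizes X (0 : E C A) iA pC.

Definition realizes_sum : Prop :=
  forall (A B C A' B' C' SA SB SC : X) (d : E C A) (d' : E C' A')
    (x : mor A B) (y : mor B C) (x' : mor A' B') (y' : mor B' C')
    (iA : mor A SA) (iA' : mor A' SA) (pA : mor SA A) (pA' : mor SA A')
    (iB : mor B SB) (iB' : mor B' SB) (pB : mor SB B) (pB' : mor SB B')
    (iC : mor C SC) (iC' : mor C' SC) (pC : mor SC C) (pC' : mor SC C'),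
  is_biproduct iA iA' pA pA' -> is_biproduct iB iB' pB pB' ->
  is_biproduct iC iC' pC pC' ->
  realizes X d x y -> realizes X d' x' y' ->
  realizes X
    (push E iA (pull E pC d) + push E iA' (pull E pC' d'))
    (iB \c x \c pA + iB' \c x' \c pA') (iC \c y \c pB + iC' \c y' \c pB').

Definition ET3 : Prop :=
  forall (A B C A' B' C' : X) (d : E C A) (d' : E C' A')
    (x : mor A B) (y : mor B C) (x' : mor A' B') (y' : mor B' C')
    (a : mor A A') (b : mor B B'),
  realizes X d x y -> realizes X d' x' y' -> b \c x = x' \c a ->
  exists c : mor C C', c \c y = y' \c b /\ push E a d = pull E c d'.

Definition ET3op : Prop :=
  forall (A B C A' B' C' : X) (d : E C A) (d' : E C' A')
    (x : mor A B) (y : mor B C) (x' : mor A' B') (y' : mor B' C')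
    (b : mor B B') (c : mor C C'),
  realizes X d x y -> realizes X d' x' y' -> c \c y = y' \c b ->
  exists a : mor A A', b \c x = x' \c a /\ push E a d = pull E c d'.

Definition ET4 : Prop :=
  forall (A B C D F : X) (d : E D A) (d' : E F B)
    (f : mor A B) (f' : mor B D) (g : mor B C) (g' : mor C F),
  realizes X d f f' -> realizes X d' g g' ->
  exists (G : X) (u : mor D G) (v : mor G F) (h' : mor C G) (d'' : E G A),
    [/\ realizes X d'' (g \c f) h',
        h' \c g = u \c f' /\ v \c h' = g',
        realizes X (push E f' d') u v,
        pull E u d'' = d
      & push E f d'' = pull E v d'].

Definition ET4op : Prop :=
  forall (A B C D F : X) (d : E A D) (d' : E B F)
    (f : mor B A) (f' : mor D B) (g : mor C B) (g' : mor F C),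
  realizes X d f' f -> realizes X d' g' g ->
  exists (G : X) (u : mor G D) (v : mor F G) (h' : mor G C) (d'' : E A G),
    [/\ realizes X d'' h' (f \c g),
        g \c h' = f' \c u /\ h' \c v = g',
        realizes X (pull E f' d') v u,
        push E u d'' = d
      & pull E f d'' = push E v d'].

Record extriangulated : Prop := Extriangulated {
  ext_additive : additive_cat X;
  ext_class : realizes_class;
  ext_morphisms : realizes_morphisms;
  ext_zero : realizes_zero;
  ext_sum : realizes_sum;
  ext_ET3 : ET3;
  ext_ET3op : ET3op;
  ext_ET4 : ET4;
  ext_ET4op : ET4op
}.

Definition ext_finite : Prop := forall C A : X, fin_gen (E C A).

Definition projective (P : X) : Prop := forall (A : X) (d : E P A), d = 0.
Definition injective_obj (I : X) : Prop := forall (C : X) (d : E C I), d = 0.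

Definition enough_projectives : Prop :=
  forall C : X, exists (A P : X) (d : E C A) (x : mor A P) (y : mor P C),
    projective P /\ realizes X d x y.
Definition enough_injectives : Prop :=
  forall A : X, exists (I C : X) (d : E C A) (x : mor A I) (y : mor I C),
    injective_obj I /\ realizes X d x y.

Definition almost_split (C A : X) (d : E C A) : Prop :=
  [/\ d <> 0,
      forall (A' : X) (a : mor A A'), ~ is_section a -> push E a d = 0
    & forall (C' : X) (c : mor C' C), ~ is_retraction c -> pull E c d = 0].

Definition almost_split_triangle (A B C : X) (d : E C A) (x : mor A B)
    (y : mor B C) : Prop :=
  realizes X d x y /\ almost_split d.

(** ** Relative structures *)

Section Relative.
Variable P : X -> Prop.

Definition in_sub (C A : X) (d : E C A) : Prop :=
  forall (D : X) (f : mor D C), P D -> pull E f d = 0.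
Definition in_sup (C A : X) (d : E C A) : Prop :=
  forall (D : X) (f : mor A D), P D -> push E f d = 0.

Fact in_sub_submod C A : submod_axiom (@in_sub C A).
Proof.
split=> [D f _|r d d' hd hd' D f PD]; first exact: pull0.
by rewrite pull_lin hd // hd' // scaler0 addr0.
Qed.
Fact in_sup_submod C A : submod_axiom (@in_sup C A).
Proof.
split=> [D f _|r d d' hd hd' D f PD]; first exact: push0.
by rewrite push_lin hd // hd' // scaler0 addr0.
Qed.

Fact in_sub_pull C C' A (c : mor C' C) (d : E C A) :
  in_sub d -> in_sub (pull E c d).
Proof. by move=> hd D f PD; rewrite -pull_comp hd. Qed.
Fact in_sub_push C A A' (a : mor A A') (d : E C A) :
  in_sub d -> in_sub (push E a d).
Proof. by move=> hd D f PD; rewrite pull_push hd // push0. Qed.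
Fact in_sup_pull C C' A (c : mor C' C) (d : E C A) :
  in_sup d -> in_sup (pull E c d).
Proof. by move=> hd D f PD; rewrite -pull_push hd // pull0. Qed.
Fact in_sup_push C A A' (a : mor A A') (d : E C A) :
  in_sup d -> in_sup (push E a d).
Proof. by move=> hd D f PD; rewrite -push_comp hd. Qed.

Definition ext_sub : bifun X X :=
  sub_bifun (S := fun C A => Submod (in_sub_submod C A))
    in_sub_pull in_sub_push.
Definition ext_sup : bifun X X :=
  sub_bifun (S := fun C A => Submod (in_sup_submod C A))
    in_sup_pull in_sup_push.

(* (C, E_P, s|) and (C, E^P, s|) *)
Definition rel_sub : extridata R := {|
  xcat := X; xext := ext_sub;
  realizes := fun A B C d x y => realizes X (subm_val d) x y |}.
Definition rel_sup : extridata R := {|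
  xcat := X; xext := ext_sup;
  realizes := fun A B C d x y => realizes X (subm_val d) x y |}.

End Relative.

(** ** Ideal quotients *)

Section IdealQuotient.
Variable I : ideal X.
Hypothesis I_pull : forall (C' C : X) (c : mor C' C), I C' C c -> killC E c.
Hypothesis I_push : forall (A A' : X) (a : mor A A'), I A A' a -> killD E a.

Definition quot_realizes (A B C : quot_cat I) (d : quot_bifun I_pull I_push C A)
    (x : Defs.mor (quot_cat I) A B) (y : Defs.mor (quot_cat I) B C) : Prop :=
  exists (B0 : X) (x0 : mor A B0) (y0 : mor B0 C),
    realizes X (d : E C A) x0 y0 /\
    seq_equiv (C := quot_cat I) (cls (I A B0) x0) (cls (I B0 C) y0) x y.

Definition ideal_quot : extridata R := {|
  xcat := quot_cat I;
  xext := quot_bifun I_pull I_push;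
  realizes := quot_realizes |}.

End IdealQuotient.

End Extriangulated.

Arguments projective {R} X P.
Arguments injective_obj {R} X I.
Arguments almost_split {R} X {C A} d.
Arguments almost_split_triangle {R} X {A B C} d x y.

Record extricat (R : pzRingType) := ExtriCat {
  xdata :> extridata R;
  xaxioms : extriangulated xdata
}.

(** * The stable categories and their extriangulated structures *)

Section Stable.
Variables (R : pzRingType) (X : extricat R).
Local Notation E := (xext X).

Definition stable_cat : lincat R := quot_cat (P_ideal E).
Definition costable_cat : lincat R := quot_cat (I_ideal E).

Definition stable_ext : bifun stable_cat costable_cat :=
  quot_bifun (E := E) (I := P_ideal E) (K := I_ideal E)
    (fun _ _ _ h => h) (fun _ _ _ h => h).

(* With enough projectives (injectives), [stable_cat] ([costable_cat]) is the
   quotient by the ideal of the morphisms that factor through a projective (an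
   injective). *)
Lemma P_idealP (hQ : enough_projectives X) (A B : X) (f : mor X A B) :
  P_ideal E A B f <-> factors_through (projective X) f.
Proof.
split=> [kf|[Q [g [h [pQ ->]]]] D d]; last first.
  by rewrite pull_comp [pull E g d]pQ pull0.
have [K [P [d [x [y [pP re]]]]]] := hQ B.
have [_ /(_ K A)[S [i [j [p [q bip]]]]]] := ext_additive (xaxioms X).
have r0 := ext_zero (xaxioms X) bip.
have [|b [_ yb]] := ext_morphisms (xaxioms X) (a := idm K) (c := f) r0 re.
  by rewrite kf push_id.
exists P, y, (b \c j); split=> //.
have [_ qj _ _ _] := bip.
by rewrite comp_assoc yb -comp_assoc qj comp_idr.
Qed.

Lemma I_idealP (hJ : enough_injectives X) (A B : X) (f : mor X A B) :
  I_ideal E A B f <-> factors_through (injective_obj X) f.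
Proof.
split=> [kf|[Q [g [h [iQ ->]]]] D d]; last first.
  by rewrite push_comp [push E h d]iQ push0.
have [I [L [d [x [y [iI re]]]]]] := hJ A.
have [_ /(_ B L)[S [i [j [p [q bip]]]]]] := ext_additive (xaxioms X).
have r0 := ext_zero (xaxioms X) bip.
have [|b [bx _]] := ext_morphisms (xaxioms X) (a := f) (c := idm L) re r0.
  by rewrite kf pull_id.
exists I, (p \c b), x; split=> //.
have [pi1 _ _ _ _] := bip.
by rewrite -comp_assoc bx comp_assoc pi1 comp_idl.
Qed.

Fact sup_pull (A B : X) (f : mor X A B) :
  P_ideal E A B f -> killC (xext (rel_sup (projective X))) f.
Proof. by move=> kf D d; apply/val_inj/kf. Qed.

Fact sup_push (hQ : enough_projectives X) (A B : X) (f : mor X A B) :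
  P_ideal E A B f -> killD (xext (rel_sup (projective X))) f.
Proof.
move=> /(P_idealP hQ)[Q [g [h [pQ ->]]]] D d; apply: val_inj => /=.
by rewrite push_comp (subm_valP d) // push0.
Qed.

Fact sub_push (A B : X) (f : mor X A B) :
  I_ideal E A B f -> killD (xext (rel_sub (injective_obj X))) f.
Proof. by move=> kf D d; apply/val_inj/kf. Qed.

Fact sub_pull (hJ : enough_injectives X) (A B : X) (f : mor X A B) :
  I_ideal E A B f -> killC (xext (rel_sub (injective_obj X))) f.
Proof.
move=> /(I_idealP hJ)[Q [g [h [pQ ->]]]] D d; apply: val_inj => /=.
by rewrite pull_comp (subm_valP d) // pull0.
Qed.

(* The ideal quotients of (C, E^Q, s|) by [Q] and of (C, E_J, s|) by [J], on the
   same underlying categories as the duality below: see P_idealP, I_idealP. *)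
Definition stable_extri (hQ : enough_projectives X) : extridata R :=
  ideal_quot (X := rel_sup (projective X)) (I := P_ideal E)
    sup_pull (sup_push hQ).

Definition costable_extri (hJ : enough_injectives X) : extridata R :=
  ideal_quot (X := rel_sub (injective_obj X)) (I := I_ideal E)
    (sub_pull hJ) sub_push.

End Stable.

(** * Exact functors and Auslander-Reiten-Serre duality *)

Record exact_functor (R : pzRingType) (X Y : extridata R) (F : functor X Y)
    (phi : forall C A : X, {linear xext X C A -> xext Y (F C) (F A)}) : Prop := {
  exact_pull : forall (C C' A : X) (c : mor X C' C) (d : xext X C A),
    phi C' A (pull (xext X) c d) = pull (xext Y) (fmap F c) (phi C A d);
  exact_push : forall (C A A' : X) (a : mor X A A') (d : xext X C A),
    phi C A' (push (xext X) a d) = push (xext Y) (fmap F a) (phi C A d);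
  exact_realizes : forall (A B C : X) (d : xext X C A) (x : mor X A B)
    (y : mor X B C),
    realizes X d x y -> realizes Y (phi C A d) (fmap F x) (fmap F y)
}.

Arguments exact_functor {R} X Y F phi.

Section ARS.
Variables (R : comPzRingType) (J : lmodType R) (X : extricat R).

Record right_ARS_duality := RightARS {
  ars_tau : functor (stable_cat X) (costable_cat X);
  ars_eta : forall A B : stable_cat X,
    {linear mor (stable_cat X) A B -> dual J (stable_ext X B (ars_tau A))};
  ars_bij : forall A B, bijective (ars_eta A B);
  ars_natl : forall (A' A B : stable_cat X) (f : mor (stable_cat X) A B)
    (a : mor (stable_cat X) A' A) (d : stable_ext X B (ars_tau A')),
    ars_eta A' B (f \c a) d =
    ars_eta A B f (push (stable_ext X) (fmap ars_tau a) d);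
  ars_natr : forall (A B B' : stable_cat X) (f : mor (stable_cat X) A B)
    (b : mor (stable_cat X) B B') (d : stable_ext X B' (ars_tau A)),
    ars_eta A B' (b \c f) d =
    ars_eta A B f (pull (stable_ext X) b d)
}.

Definition eta_at (T : right_ARS_duality) (A : X) (d : xext X A (ars_tau T A)) :
    J :=
  ars_eta T A A (idm (l := stable_cat X) A) d.
Arguments eta_at T {A} d.

(* phi is the composite of the isomorphism d |-> ([f] |-> eta_C (f_* d)) from
   E^Q(C,A) to D((C/[W])(A, tau C)), where W = add(Q u J), and of the inverse of
   the isomorphism e |-> ([f] |-> eta_A (f^* e)) from E_J(tau C, tau A) to that
   module; the equation below determines it. *)
Definition induced_by_ARS (T : right_ARS_duality) (hQ : enough_projectives X)
    (hJ : enough_injectives X)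
    (phi : forall C A : X, xext (stable_extri hQ) C A ->
      xext (costable_extri hJ) (ars_tau T C) (ars_tau T A)) : Prop :=
  forall (C A : X) (d : xext (stable_extri hQ) C A) (f : mor X A (ars_tau T C)),
    eta_at T (pull (xext X) f (subm_val (phi C A d))) =
    eta_at T (push (xext X) f (subm_val d)).

End ARS.

Arguments induced_by_ARS {R J X} T hQ hJ phi.

(* Main.v *)
Require Import Defs.
From HB Require Import structures.
From mathcomp Require Import all_boot ssralg.
From mathcomp Require Import boolp.

(** The values [eta_C (f_* d)], [f : A -> tau C], detect whether [d] in [E(C, A)]
    is zero, and the values [eta_A (g^* e)], [g : A -> B], detect whether [e] in
    [E(B, tau A)] is zero; the latter also makes [tau] full. Hence [phi delta] is
    nonzero. If [a_* (phi delta)] is nonzero, then so is [h_* a_* (phi delta)] for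
    some [h] with target [tau (tau C)]. As [h a = tau t] for some [t], the extension
    [t_* delta] is nonzero, so [t], [tau t] and [a] are sections. If
    [c^* (phi delta)] is nonzero, then [eta_C ((c g)_* delta)] is nonzero for some
    [g], so [f = c g] is a section in the stable category, say with [s f = 1]. As
    [f s = tau t] for some [t], and [eta_C (f_* t^* delta)] equals
    [eta_C (f_* s_* f_* delta) = eta_C (f_* delta)], the morphism [t] is a
    retraction, hence so are [f s] and [c]. *)

Set Implicit Arguments.
Unset Strict Implicit.
Unset Printing Implicit Defensive.

Import GRing.Theory.
Local Open Scope ring_scope.

(** * Functionals with values in an injective cogenerator *)

Section Modules.
Variables (R : comPzRingType) (J : lmodType R).

Lemma linear_exists (M N : lmodType R) (f : M -> N) :
  linear f -> exists g : {linear M -> N}, g =1 f.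
Proof.
move=> lf; pose g : {linear M -> N} :=
  HB.pack f (GRing.isLinear.Build R M N *:%R f lf).
by exists g.
Qed.

Lemma fin_gen_quotm (M : lmodType R) (S : submod M) :
  fin_gen M -> fin_gen (quotm S).
Proof.
move=> [n [v vM]]; exists n, (fun i => cls S (v i)) => q.
have [a ea] := vM (rep q); exists a.
by rewrite -[q in LHS]repK ea linear_sum; apply: eq_bigr => i _; rewrite linearZ.
Qed.

(** As [u] vanishes on the kernel of [p], both maps descend to the quotient of [M] by it, which is
    finitely generated and embeds in [N]; injectivity of [J] then applies. *)
Lemma extend_along (M N : lmodType R) (p : {linear M -> N}) (u : {linear M -> J}) :
  injective_mod J -> fin_gen M -> fin_gen N ->
  (forall m, p m = 0 -> u m = 0) ->
  exists g : {linear N -> J}, forall m, g (p m) = u m.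
Proof.
move=> injJ fM fN ker_pu.
have kerP : submod_axiom (fun m => p m = 0).
  by split=> [|a m m' pm pm']; rewrite ?raddf0 // linearP pm pm' scaler0 addr0.
pose K := Submod kerP.
have p_cls m : p (rep (cls K m)) = p m.
  by have /clsP/= := repK (cls K m); rewrite linearB => /subr0_eq.
have u_cls m : u (rep (cls K m)) = u m.
  by have /clsP/ker_pu/= := repK (cls K m); rewrite linearB => /subr0_eq.
have [|i iE] := @linear_exists (quotm K) N (fun q => p (rep q)).
  move=> a q q'; rewrite -[q]repK -[q']repK -(linearP (cls K)).
  by rewrite !p_cls linearP.
have [|f fE] := @linear_exists (quotm K) J (fun q => u (rep q)).
  move=> a q q'; rewrite -[q]repK -[q']repK -(linearP (cls K)).
  by rewrite !u_cls linearP.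
have [|||g gE] := injJ _ _ i f => //.
- exact: fin_gen_quotm.
- move=> q q'; rewrite !iE => pq; rewrite -[q]repK -[q']repK.
  by apply/clsP => /=; rewrite linearB /= pq subrr.
by exists g => m; rewrite -p_cls -iE gE fE u_cls.
Qed.

(** A nonzero [m] gives a nonzero map from [R] to [M] sending 1 to [m], which some functional on [M]
    must detect. *)
Lemma cogenerator_separates (M : lmodType R) (m : M) :
  cogenerator_mod J -> fin_gen M -> (forall g : {linear M -> J}, g m = 0) ->
  m = 0.
Proof.
move=> cogJ fM gm0; apply: contrapT => /eqP m0.
have [|f fE] := @linear_exists R^o M (fun r => r *: m).
  by move=> a r r'; rewrite scalerDl scalerA.
have [|||g [r]] := cogJ _ _ f => //.
- exists 1, (fun=> 1 : R^o) => r; exists (fun=> r).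
  by rewrite big_ord1 /= /GRing.scale /= mulr1.
- by exists (1 : R^o); rewrite fE scale1r.
by rewrite fE linearZ /= gm0 scaler0 eqxx.
Qed.

End Modules.

Lemma cls_comp (R : pzRingType) (C : lincat R) (I : ideal C) (A B D : C)
    (g : mor C B D) (f : mor C A B) :
  cls (I A D) (g \c f) =
  mcomp (l := quot_cat I) (cls (I B D) g) (cls (I A B) f).
Proof. by rewrite [RHS]qcomp_cls. Qed.

(** * Exactness of Hom and extension groups along a triangle *)

Section LongExactSequence.
Variables (R : pzRingType) (X : extricat R).
Local Notation E := (xext X).

Lemma realizes_split (A C : X) :
  exists (S : X) (iA : mor X A S) (iC : mor X C S) (pA : mor X S A)
    (pC : mor X S C), is_biproduct iA iC pA pC /\ realizes X (0 : E C A) iA pC.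
Proof.
have [_ /(_ A C)[S [iA [iC [pA [pC bip]]]]]] := ext_additive (xaxioms X).
by exists S, iA, iC, pA, pC; split=> //; apply: (ext_zero (xaxioms X)) bip.
Qed.

(** The pair (1, c) is a morphism from the split extension of [D] by [A] to [d]; its middle
    component restricted to [D] is the lift. *)
Lemma pull_eq0_lift (A B C D : X) (d : E C A) (x : mor X A B) (y : mor X B C)
    (c : mor X D C) :
  realizes X d x y -> pull E c d = 0 -> exists b : mor X D B, c = y \c b.
Proof.
move=> re cd.
have [S [i [j [p [q [[_ qj _ _ _] r0]]]]]] := realizes_split A D.
have [|b [_ yb]] := ext_morphisms (xaxioms X) (a := idm A) (c := c) r0 re.
  by rewrite cd push_id.
by exists (b \c j); rewrite comp_assoc yb -comp_assoc qj comp_idr.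
Qed.

Lemma pull_realizes0 (A B C : X) (d : E C A) (x : mor X A B) (y : mor X B C) :
  realizes X d x y -> pull E y d = 0.
Proof.
move=> re; have [S [i [j [p [q [[pi qj pj qi _] r0]]]]]] := realizes_split A B.
have compDl A1 B1 C1 (g g' : mor X B1 C1) (f : mor X A1 B1) :
  (g + g') \c f = g \c f + g' \c f by rewrite -[g]scale1r comp_linl !scale1r.
have comp0r A1 B1 C1 (g : mor X B1 C1) : g \c (0 : mor X A1 B1) = 0.
  by rewrite -(subrr 0) comp_subr subrr.
(* The map from the biproduct of [A] and [B] to [B] with components [x] and 1 forces the third
   component to be [y]. *)
have [|c [cq]] := ext_ET3 (xaxioms X) (a := idm A) (b := x \c p + q) r0 re.
  by rewrite compDl -comp_assoc pi qi addr0.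
have -> : c = y.
  rewrite -[c]comp_idr -qj comp_assoc cq -comp_assoc compDl -comp_assoc pj qj.
  by rewrite comp0r add0r comp_idr.
by rewrite push_id => <-.
Qed.

(** As y^* e = 0, [y] lifts through the second map of a triangle of [e]; the dual of (ET3), with the
    identity of [C], yields [a]. *)
Lemma pull_eq0_push (A B C Z : X) (d : E C A) (x : mor X A B) (y : mor X B C)
    (e : E C Z) :
  realizes X d x y -> pull E y e = 0 -> exists a : mor X A Z, e = push E a d.
Proof.
move=> re ye.
have [[W [z [w rw]]] _] := ext_class (xaxioms X) e.
have [b yE] := pull_eq0_lift rw ye.
have [|a [_ ad]] := ext_ET3op (xaxioms X) (b := b) (c := idm C) re rw.
  by rewrite comp_idl.
by exists a; rewrite ad pull_id.
Qed.

(** As x_* e = 0, [x] extends along the first map of a triangle of [e]; (ET3), with the identity of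
    [A], yields [c]. *)
Lemma push_eq0_pull (A B C D : X) (d : E C A) (x : mor X A B) (y : mor X B C)
    (e : E D A) :
  realizes X d x y -> push E x e = 0 -> exists c : mor X D C, e = pull E c d.
Proof.
move=> re xe.
have [[W [z [w rw]]] _] := ext_class (xaxioms X) e.
have [S [i [j [p [q [[pi _ _ _ _] r0]]]]]] := realizes_split B D.
have [|b [bz _]] := ext_morphisms (xaxioms X) (a := x) (c := idm D) rw r0.
  by rewrite xe pull_id.
have [|c [_ ec]] := ext_ET3 (xaxioms X) (a := idm A) (b := p \c b) rw re.
  by rewrite -comp_assoc bz comp_assoc pi comp_idl comp_idr.
by exists c; rewrite -ec push_id.
Qed.

End LongExactSequence.

(** * Separation of extensions by [eta_at], and fullness of [tau] *)

Section Duality.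
Variables (R : comPzRingType) (J : lmodType R) (X : extricat R).
Hypothesis hJ : injective_cogenerator J.
Hypothesis hfin : ext_finite X.
Variable T : right_ARS_duality J X.
Local Notation E := (xext X).
Local Notation tau := (ars_tau T).
Local Notation st := (cls (P_ideal E _ _)).
Local Notation cost := (cls (I_ideal E _ _)).

Lemma ars_etaE (A B : X) (g : mor X A B) (d : E B (tau A)) :
  ars_eta T A B (st g) d = eta_at (pull E g d).
Proof.
rewrite /eta_at -[st g](comp_idr (l := stable_cat X)) ars_natr.
by congr (ars_eta T A A _ _); exact: (qpull_cls (E := E) (I := P_ideal E)).
Qed.

Lemma ars_eta_surj (A B : X) (u : {linear E B (tau A) -> J}) :
  exists g : mor X A B, forall d, u d = eta_at (pull E g d).
Proof.
have [r _ rK] := ars_bij T A B.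
exists (rep (r u)) => d; rewrite -ars_etaE repK.
by have -> : ars_eta T A B (r u) = u by rewrite rK.
Qed.

(** Both sides are the functional of [t] at [d]: write [t] as t 1 and as 1 t, and use naturality in
    either variable. *)
Lemma eta_at_push_tau (A B : X) (t : mor X A B) (b : mor X (tau A) (tau B))
    (d : E B (tau A)) :
  fmap tau (st t) = cost b ->
  eta_at (pull E t d) = eta_at (push E b d).
Proof.
move=> tb; rewrite -ars_etaE /eta_at.
rewrite -[st t](comp_idl (l := stable_cat X)) ars_natl tb.
by congr (ars_eta T B B _ _); exact: (qpush_cls (E := E) (K := I_ideal E)).
Qed.

Lemma eta_separates_pull (A B : X) (e : E B (tau A)) :
  (forall g : mor X A B, eta_at (pull E g e) = 0) -> e = 0.
Proof.
move=> e0; have [_ _ cogJ] := hJ.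
apply: (cogenerator_separates cogJ) => // u.
by have [g ->] := ars_eta_surj u.
Qed.

(** The functional sending [d] to eta_B(b_* d) comes from some [t]. The difference of tau t and [b]
    then pushes every extension to one that all pairings kill, so it lies in [I_ideal]. *)
Lemma tau_full (A B : X) (b : mor X (tau A) (tau B)) :
  exists t : mor X A B, fmap tau (st t) = cost b.
Proof.
have [|u uE] := @linear_exists R (E B (tau A)) J (fun d => eta_at (push E b d)).
  by move=> a d d'; rewrite push_lin /eta_at linearP.
have [t tE] := ars_eta_surj u; exists t.
pose b' := rep (fmap tau (st t)).
have b'E : fmap tau (st t) = cost b' by rewrite repK.
rewrite b'E; apply/clsP => C d /=; apply: eta_separates_pull => g.
rewrite pull_push addrC -scaleN1r push_lin_hom /eta_at linearP /=.
rewrite -!/(eta_at _) -uE tE.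
by rewrite (eta_at_push_tau _ b'E) scaleN1r addNr.
Qed.

(* Write [d] as the pullback along [u : C -> A'] of a triangle [A -> I -> A'] with
   [I] injective. The functional of [u] on [E(A', tau C)] kills the kernel of
   [y^*], so it extends to [E(I, tau C)]; hence [u] factors through [y] modulo
   [P_ideal], and [d] vanishes. *)
Lemma eta_separates_push (enJ : enough_injectives X) (A C : X) (d : E C A) :
  (forall f : mor X A (tau C), eta_at (push E f d) = 0) -> d = 0.
Proof.
move=> d0; have [_ injJ _] := hJ.
have [I [A' [io [x [y [iI re]]]]]] := enJ A.
have [|u uE] := push_eq0_pull (e := d) re; first exact: iI.
have [|p pE] := @linear_exists R (E A' (tau C)) (E I (tau C)) (pull E y).
  by move=> a e e'; rewrite pull_lin.
have [|v vE] := @extend_along R J _ _ p (ars_eta T C A' (st u))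
  injJ (hfin _ _) (hfin _ _).
  (* The kernel of y^* consists of the f_* [io], where the functional takes the value eta_C(f_* d) =
     0. *)
  move=> e; rewrite pE => /(pull_eq0_push re)[f ->].
  by rewrite ars_etaE pull_push -uE d0.
have [g gE] := ars_eta_surj v.
have /clsP/(_ A io) : st (y \c g) = st u.
  apply: (bij_inj (ars_bij T C A')); apply: dual_ext => e.
  by rewrite -vE gE pE ars_etaE pull_comp.
rewrite addrC -scaleN1r pull_lin_hom pull_comp (pull_realizes0 re) pull0 addr0.
by rewrite -uE scaleN1r => /eqP; rewrite oppr_eq0 => /eqP.
Qed.

End Duality.

(** * Action of stable and costable classes on relative extensions *)

Section StableStructures.
Variables (R : pzRingType) (X : extricat R).
Local Notation E := (xext X).
Variables (enQ : enough_projectives X) (enJ : enough_injectives X).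

Lemma stable_pushE (C A A' : X) (a : mor X A A')
    (d : xext (stable_extri enQ) C A) :
  subm_val (push (xext (stable_extri enQ)) (cls (P_ideal E A A') a) d) =
  push E a (subm_val d).
Proof. exact: (congr1 val (qpush_cls (sup_push enQ) a d)). Qed.

Lemma stable_pullE (C C' A : X) (c : mor X C' C)
    (d : xext (stable_extri enQ) C A) :
  subm_val (pull (xext (stable_extri enQ)) (cls (P_ideal E C' C) c) d) =
  pull E c (subm_val d).
Proof. exact: (congr1 val (qpull_cls (@sup_pull R X) c d)). Qed.

Lemma costable_pushE (C A A' : X) (a : mor X A A')
    (d : xext (costable_extri enJ) C A) :
  subm_val (push (xext (costable_extri enJ)) (cls (I_ideal E A A') a) d) =
  push E a (subm_val d).
Proof. exact: (congr1 val (qpush_cls (@sub_push R X) a d)). Qed.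

End StableStructures.

(** * Almost split extensions under [phi] *)

Theorem proposition4p7 (R : comPzRingType) (hR : artinian R)
  (J : lmodType R) (hJ : minimal_injective_cogenerator J)
  (X : extricat R) (hfin : ext_finite X)
  (hwic : weakly_idempotent_complete X)
  (T : right_ARS_duality J X)
  (enQ : enough_projectives X) (enJ : enough_injectives X)
  (ffQ : functorially_finite (projective X))
  (ffJ : functorially_finite (injective_obj X))
  (phi : forall C A : X,
     {linear xext (stable_extri enQ) C A ->
       xext (costable_extri enJ) (ars_tau T C) (ars_tau T A)})
  (phiT : induced_by_ARS T enQ enJ phi)
  (exact_phi : exact_functor (stable_extri enQ) (costable_extri enJ)
     (ars_tau T) phi) :
  (forall (C A : X) (delta : xext (stable_extri enQ) C A),
     almost_split (stable_extri enQ) delta ->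
     almost_split (costable_extri enJ) (phi C A delta)) /\
  (forall (A B C : X) (delta : xext (stable_extri enQ) C A)
     (x : mor (stable_extri enQ) A B) (y : mor (stable_extri enQ) B C),
     almost_split_triangle (stable_extri enQ) delta x y ->
     almost_split_triangle (costable_extri enJ) (phi C A delta)
       (fmap (ars_tau T) x) (fmap (ars_tau T) y)).
Proof.
have {}hJ := hJ.1.
suff main (C A : X) (d : xext (stable_extri enQ) C A) :
    almost_split (stable_extri enQ) d ->
    almost_split (costable_extri enJ) (phi C A d).
  split=> [//|A B C d x y [re ad]]; split; last exact: main.
  exact: (exact_realizes exact_phi).
move=> [d0 dsec dret]; split.
- move=> phid0; apply: d0; apply: val_inj => /=.
  apply: (eta_separates_push (T := T) hJ hfin enJ) => f.
  by rewrite -phiT phid0 /= pull0 /eta_at linear0.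
- move=> A' a nsec; apply: val_inj => /=.
  apply: (eta_separates_push (T := T) hJ hfin enJ) => h.
  rewrite -push_comp; have [t tE] := tau_full hJ hfin (h \c rep a).
  pose tc : mor (stable_extri enQ) A (ars_tau T C) := cls (P_ideal _ _ _) t.
  have -> : push (xext X) (h \c rep a) (subm_val (phi C A d)) =
      subm_val (phi C _ (push (xext (stable_extri enQ)) tc d)).
    by rewrite (exact_push exact_phi) tE costable_pushE.
  (* If [tc] had a left inverse [r], then tau(r) h would be a left inverse of [a]. *)
  rewrite dsec ?raddf0 /eta_at ?linear0 // => -[r rtc]; apply: nsec.
  pose hc : mor (costable_cat X) A' _ := cls (I_ideal (xext X) _ _) h.
  have hcE : mcomp (l := costable_cat X) hc a = fmap (ars_tau T) tc.
    by rewrite tE [RHS]cls_comp repK.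
  exists (mcomp (l := costable_cat X) (fmap (ars_tau T) r) hc).
  rewrite -(comp_assoc (l := costable_cat X)) hcE.
  by rewrite -(fmap_comp (ars_tau T)) rtc fmap_id.
move=> C' c nret; apply: val_inj => /=.
apply: (eta_separates_pull (T := T) hJ hfin) => g.
rewrite -pull_comp phiT; set f := rep c \c g; apply: contrapT => fd0.
have [s sf] : is_section
    (cls (P_ideal (xext X) _ _) f : mor (stable_extri enQ) A (ars_tau T C)).
  apply: contrapT => /dsec/(congr1 (@subm_val _ _ _)); rewrite stable_pushE => fd.
  by apply: fd0; rewrite fd /eta_at linear0.
have [t tE] := tau_full hJ hfin (f \c rep s).
pose tc : mor (stable_extri enQ) C C := cls (P_ideal _ _ _) t.
have [k tk] : is_retraction tc.
  apply: contrapT => /dret/(congr1 (@subm_val _ _ _)); rewrite stable_pullE => td.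
  (* Here s f = 1 holds only modulo [P_ideal], but pushing [d] along such morphisms gives zero. *)
  have fsfd : push (xext X) (rep s) (push (xext X) f (subm_val d)) = subm_val d.
    rewrite -push_comp -stable_pushE.
    have -> : cls (P_ideal (xext X) A A) (rep s \c f) = idm (l := stable_cat X) A.
      by rewrite cls_comp repK.
    by rewrite push_id.
  (* eta_C(f_* d) = eta_C((f s)_* f_* d) = eta_C(t^* f_* d) = eta_C(f_* t^* d) = 0. *)
  apply: fd0; rewrite -fsfd -[push _ f (push _ (rep s) _)]push_comp.
  rewrite -(eta_at_push_tau _ tE) pull_push td.
  by rewrite push0 /eta_at linear0.
apply: nret.
(* As c (g s) = tau t and t k = 1, the composite g s tau(k) is a right inverse of [c]. *)
pose gs : mor (costable_cat X) _ C' := cls (I_ideal (xext X) _ _) (g \c rep s).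
have gsE : mcomp (l := costable_cat X) c gs = fmap (ars_tau T) tc.
  by rewrite tE /f -comp_assoc [RHS]cls_comp repK.
exists (mcomp (l := costable_cat X) gs (fmap (ars_tau T) k)).
rewrite (comp_assoc (l := costable_cat X)) gsE.
by rewrite -(fmap_comp (ars_tau T)) tk fmap_id.
Qed.
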